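(* Let $U$ be a supertropical semiring and $S$ an arbitrary subset of $U$. The equivalence classes of the fiberwise equalizer $\mathrm{Feq}(S)$ are the $S$-components of $US$ and the one-element sets $\{z\}$ with $z\in U\setminus US$.
   Context: A supertropical semiring is a commutative semiring $U$ such that $e:=1+1$ is idempotent ($e+e=e$) and, for all $a,b\in U$, $a+b\in\{a,b\}$ if $ea\ne eb$, and $a+b=ea$ if $ea=eb$. (Then $ea=0\Rightarrow a=0$, and $M:=eU$ is totally ordered by $a\le b\Leftrightarrow a+b=b$.) An MFCE-relation on $U$ is an equivalence relation $E$ with $x\sim_Ey\Rightarrow xz\sim_Eyz$ for all $z\in U$, and $x\sim_Ey\Rightarrow ex=ey$. The fiberwise equalizer $\mathrm{Feq}(S)$ of $S\subset U$ is the finest MFCE-relation $E$ on $U$ such that $s\sim_Et$ for any two $s,t\in S$ with $es=et$. $US:=\{us\mid u\in U,\ s\in S\}$. An $S$-path in $U$ from $z$ to $w$ ($z,w\in U$) is a finite sequence of triples $(s_k,u_k,t_k)\in S\times U\times S$, $1\le k\le n$ ($n\ge1$), with $es_k=et_k$ for all $k$, together with elements $z=z_1,z_2,\dots,z_{n+1}=w$ of $U$ such that $u_ks_k=z_k$ and $u_kt_k=z_{k+1}$ for $1\le k\le n$. Elements $z,w\in US$ are $S$-connected if there is an $S$-path from $z$ to $w$. This is an equivalence relation on $US$; its classes are called the $S$-components of $US$. *)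

(* Defs.v *)
From HB Require Import structures.
From Corelib Require Import RelationClasses.
From mathcomp Require Import all_boot all_algebra.
From mathcomp Require Import boolp classical_sets.

Set Implicit Arguments.
Unset Strict Implicit.
Unset Printing Implicit Defensive.

Import GRing.Theory.

Local Open Scope classical_set_scope.
Local Open Scope ring_scope.

Definition ghost_unit {U : pzSemiRingType} : U := 1 + 1.

(* The trivial semiring (0 = 1) is not excluded. *)
HB.mixin Record ComPzSemiRing_isSupertropical U of GRing.ComPzSemiRing U := {
  ghost_unit_idem : ghost_unit + ghost_unit = ghost_unit :> U;
  add_bipotent : forall a b : U,
    ghost_unit * a <> ghost_unit * b -> a + b = a \/ a + b = b;
  add_ghost : forall a b : U,
    ghost_unit * a = ghost_unit * b -> a + b = ghost_unit * a
}.

#[short(type="supertropicalType")]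
HB.structure Definition Supertropical :=
  { U of ComPzSemiRing_isSupertropical U & GRing.ComPzSemiRing U }.

Record MFCE (U : supertropicalType) (E : U -> U -> Prop) : Prop := {
  MFCE_equiv : Equivalence E;
  MFCE_mul : forall x y z : U, E x y -> E (x * z) (y * z);
  MFCE_fiber : forall x y : U, E x y -> ghost_unit * x = ghost_unit * y
}.

Definition fiber_equalizing (U : supertropicalType) (S : set U)
    (E : U -> U -> Prop) : Prop :=
  forall s t : U, S s -> S t -> ghost_unit * s = ghost_unit * t -> E s t.

(* The finest relation is the intersection of all candidates; Feq_finest below
   shows that this intersection is itself a candidate. *)
Definition Feq (U : supertropicalType) (S : set U) (x y : U) : Prop :=
  forall E : U -> U -> Prop, MFCE E -> fiber_equalizing S E -> E x y.

Lemma Feq_finest (U : supertropicalType) (S : set U) :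
  [/\ MFCE (Feq S), fiber_equalizing S (Feq S) &
      forall E : U -> U -> Prop, MFCE E -> fiber_equalizing S E ->
        forall x y : U, Feq S x y -> E x y].
Proof.
split; last by move=> E mE sE x y; apply.
- split.
  + split.
    * by move=> x E [[r _ _] _ _] _; exact: r.
    * by move=> x y xy E mE sE; case: (mE) => -[_ s _] _ _; exact: s (xy E mE sE).
    * move=> x y z xy yz E mE sE; case: (mE) => -[_ _ t] _ _.
      by exact: t (xy E mE sE) (yz E mE sE).
  + by move=> x y z xy E mE sE; apply: (MFCE_mul mE); exact: xy.
  + move=> x y xy.
    apply: (xy (fun a b => ghost_unit * a = ghost_unit * b)) => //.
    split=> //; first by split=> // x' y' z' -> ->.
    by move=> x' y' z exy; rewrite !mulrA exy.
- by move=> s t Ss St est E _; apply.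
Qed.

Definition US (U : supertropicalType) (S : set U) : set U :=
  [set u * s | u in [set: U] & s in S].

(* Indices are shifted to start at 0: s k, u k, t k for k < n and zs k for
   k <= n; widen_ord (leqnSn n) k and lift ord0 k are k and k + 1 in 'I_n.+1. *)
Record is_S_path (U : supertropicalType) (S : set U) (z w : U) (n : nat)
    (s u t : 'I_n -> U) (zs : 'I_n.+1 -> U) : Prop := {
  S_path_length : (1 <= n)%N;
  S_path_memS : forall k, S (s k) /\ S (t k);
  S_path_fiber : forall k, ghost_unit * s k = ghost_unit * t k;
  S_path_start : zs ord0 = z;
  S_path_end : zs ord_max = w;
  S_path_src : forall k, u k * s k = zs (widen_ord (leqnSn n) k);
  S_path_tgt : forall k, u k * t k = zs (lift ord0 k)
}.

Definition S_connected (U : supertropicalType) (S : set U) (z w : U) : Prop :=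
  exists n (s u t : 'I_n -> U) (zs : 'I_n.+1 -> U),
    is_S_path S z w s u t zs.

Definition classes (T : Type) (A : set T) (R : T -> T -> Prop) : set (set T) :=
  [set [set y | A y /\ R x y] | x in A].

Definition S_components (U : supertropicalType) (S : set U) : set (set U) :=
  classes (US S) (S_connected S).

(* Main.v *)
Require Import Defs.
From Stdlib Require Import Relation_Operators Operators_Properties.
From mathcomp Require Import all_boot all_algebra.
From mathcomp Require Import boolp classical_sets.

(* Both "equal" and "S-connected" survive multiplication by any element, since
   a step from us to ut becomes a step from (zu)s to (zu)t.  So the relation
   "equal or S-connected" is an MFCE-relation; it equalizes the fibers of S
   (take u = 1), and every step from us to ut is forced in any MFCE-relation
   doing so.  Hence it is Feq(S), and its classes can be read off. *)

Local Open Scope classical_set_scope.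
Local Open Scope ring_scope.
Import GRing.Theory.
Set Implicit Arguments.
Unset Strict Implicit.

(** The [S]-paths of length one. Their transitive closure replaces paths indexed by ordinals, so
    that later arguments are inductions on the closure. *)
Definition S_step (U : supertropicalType) (S : set U) (z w : U) : Prop :=
  exists s u t : U, [/\ S s, S t, ghost_unit * s = ghost_unit * t,
                       u * s = z & u * t = w].

Lemma S_step_connected (U : supertropicalType) (S : set U) (z w : U) :
  S_step S z w -> S_connected S z w.
Proof.
move=> [s [u [t [Ss St est <- <-]]]].
exists 1%N, (fun=> s), (fun=> u), (fun=> t),
  (fun i => if i == ord0 then u * s else u * t).
by split=> // k; rewrite (ord1 k).
Qed.

Lemma S_step_connected_trans (U : supertropicalType) (S : set U) (z w v : U) :
  S_step S z w -> S_connected S w v -> S_connected S z v.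
Proof.
move=> [s0 [u0 [t0 [Ss St est uz uw]]]] [n [s [u [t [zs p]]]]].
case: p => n_gt0 memS fib start stop src tgt.
(* The new step goes in front: [a] takes index 0 and the old entries move up by one. *)
pose cons m (a : U) (f : 'I_m -> U) (k : 'I_m.+1) :=
  if unlift ord0 k is Some j then f j else a.
have cons0 m a f : @cons m a f ord0 = a by rewrite /cons unlift_none.
have consS m a f j : @cons m a f (lift ord0 j) = f j by rewrite /cons liftK.
exists n.+1, (cons n s0 s), (cons n u0 u), (cons n t0 t), (cons n.+1 z zs).
split=> //.
- by move=> k; case: (unliftP ord0 k) => [j|] ->; rewrite ?consS ?cons0.
- by move=> k; case: (unliftP ord0 k) => [j|] ->; rewrite ?consS ?cons0.
- have -> : ord_max = lift ord0 (ord_max : 'I_n.+1) by exact: val_inj.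
  by rewrite consS.
- move=> k; case: (unliftP ord0 k) => [j|] ->.
    have -> : widen_ord (leqnSn n.+1) (lift ord0 j) =
              lift ord0 (widen_ord (leqnSn n) j) by exact: val_inj.
    by rewrite !consS.
  have -> : widen_ord (leqnSn n.+1) ord0 = ord0 by exact: val_inj.
  by rewrite !cons0.
(* The targets are the vertices of the old path; at index 0 this is where the new step ends and the
   old path starts, namely [w]. *)
- move=> k; rewrite consS; case: (unliftP ord0 k) => [j|] ->.
    by rewrite !consS.
  by rewrite !cons0 start.
Qed.

(** A path is a chain of steps through its vertices. The closure is not reflexive because paths have
    length at least 1. *)
Lemma S_connectedE (U : supertropicalType) (S : set U) (z w : U) :
  S_connected S z w <-> clos_trans U (S_step S) z w.
Proof.
split; last first.
  (* This form of the closure splits off the first step, matching the extension of paths at the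
     front. *)
  move=> /clos_trans_t1n_iff; elim=> [x y|x y v xy _].
    exact: S_step_connected.
  exact: S_step_connected_trans.
move=> [n [s [u [t [zs [n_gt0 memS fib <- <- src tgt]]]]]].
have step k : S_step S (zs (widen_ord (leqnSn n) k)) (zs (lift ord0 k)).
  by exists (s k), (u k), (t k); case: (memS k).
(* Induction along the vertices, beginning at vertex 1 since vertex 0 need not be reached from
   itself by the empty chain. *)
have reach k (lt_k : (k.+1 < n.+1)%N) :
    clos_trans U (S_step S) (zs ord0) (zs (Ordinal lt_k)).
  elim: k lt_k => [|k IHk] lt_k.
    have := step (@Ordinal n 0 lt_k).
    set a := widen_ord _ _; set b := lift _ _ => ab.
    have -> : ord0 = a by exact: val_inj.
    have -> : Ordinal lt_k = b by exact: val_inj.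
    exact: t_step.
  have := step (@Ordinal n k.+1 lt_k).
  set a := widen_ord _ _; set b := lift _ _ => ab.
  have -> : Ordinal lt_k = b by exact: val_inj.
  apply: t_trans (t_step _ _ _ _ ab).
  have -> : a = Ordinal (ltnW lt_k) by exact: val_inj.
  exact: IHk.
(* As [n] is positive, the last vertex has an index of the form [k.+1]. *)
have lt_n : (n.-1.+1 < n.+1)%N by rewrite prednK.
have -> : ord_max = Ordinal lt_n by apply: val_inj; rewrite /= prednK.
exact: reach.
Qed.

(** Both ends of a step are multiples of elements of [S]. Hence a point outside [US S] is connected
    to nothing, not even to itself. *)
Lemma S_connected_US (U : supertropicalType) (S : set U) (z w : U) :
  S_connected S z w -> US S z /\ US S w.
Proof.
move=> /S_connectedE; elim=> [x y|x y v _ [? _] _ [_ ?]] //.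
by move=> [s [u [t [Ss St _ <- <-]]]]; split;
  exists u => //; [exists s | exists t].
Qed.

Lemma S_connected_refl (U : supertropicalType) (S : set U) (z : U) :
  US S z -> S_connected S z z.
Proof. by move=> [u _ [s Ss <-]]; apply: S_step_connected; exists s, u, s. Qed.

Lemma S_connected_sym (U : supertropicalType) (S : set U) (z w : U) :
  S_connected S z w -> S_connected S w z.
Proof.
move=> /S_connectedE zw; apply/S_connectedE; elim: zw => [x y|x y v _ yx _ vy].
  by move=> [s [u [t [Ss St est us ut]]]]; apply: t_step; exists t, u, s.
exact: t_trans vy yx.
Qed.

Lemma S_connected_trans (U : supertropicalType) (S : set U) (x y z : U) :
  S_connected S x y -> S_connected S y z -> S_connected S x z.
Proof.
move=> /S_connectedE xy /S_connectedE yz; apply/S_connectedE.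
exact: t_trans xy yz.
Qed.

Lemma S_connected_mul (U : supertropicalType) (S : set U) (x y z : U) :
  S_connected S x y -> S_connected S (x * z) (y * z).
Proof.
move=> /S_connectedE xy; apply/S_connectedE; elim: xy => [a b|a b c _ ab _ bc].
  move=> [s [u [t [Ss St est <- <-]]]]; apply: t_step.
  by exists s, (u * z), t; split=> //; rewrite mulrAC.
exact: t_trans ab bc.
Qed.

Lemma S_connected_fiber (U : supertropicalType) (S : set U) (x y : U) :
  S_connected S x y -> ghost_unit * x = ghost_unit * y.
Proof.
move=> /S_connectedE; elim=> [a b|a b c _ -> _ ->] //.
by move=> [s [u [t [_ _ est <- <-]]]]; rewrite mulrCA est mulrCA.
Qed.

(** The disjunct [x = y] supplies reflexivity outside [US S]. *)
Lemma S_connected_MFCE (U : supertropicalType) (S : set U) :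
  MFCE (fun x y : U => x = y \/ S_connected S x y).
Proof.
split; first split.
- by move=> x; left.
- by move=> x y [->|xy]; [left|right; exact: S_connected_sym].
- move=> x y z [-> //|xy] [<-|yz]; right=> //.
  exact: S_connected_trans xy yz.
- by move=> x y z [->|xy]; [left|right; exact: S_connected_mul].
- by move=> x y [->|/S_connected_fiber].
Qed.

Lemma FeqE (U : supertropicalType) (S : set U) (x y : U) :
  Feq S x y <-> x = y \/ S_connected S x y.
Proof.
have [[[Frefl _ Ftrans] Fmul _] Feq_fiber _] := Feq_finest S.
split; last case=> [->|/S_connectedE].
- move=> xy; apply: (xy _ (S_connected_MFCE S)).
  move=> s t Ss St est; right; apply: S_step_connected.
  by exists s, 1, t; split; rewrite ?mul1r.
- exact: Frefl.
- elim=> [a b|a b c _ ab _ bc]; last exact: Ftrans ab bc.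
  (* The multiplier [u] moves to the right, where [MFCE_mul] expects it. *)
  move=> [s [u [t [Ss St est <- <-]]]]; rewrite ![u * _]mulrC.
  by apply: Fmul; exact: Feq_fiber.
Qed.

(** On [US S] every point has the constant step [s = t] to itself, so connectedness absorbs the case
    of equality. *)
Lemma Feq_class_US (U : supertropicalType) (S : set U) (x : U) :
  US S x ->
  [set y | [set: U] y /\ Feq S x y] = [set y | US S y /\ S_connected S x y].
Proof.
move=> USx; apply/seteqP; split=> y /=.
  move=> [_ /FeqE[<-|xy]]; first by split=> //; exact: S_connected_refl.
  by split=> //; case: (S_connected_US xy).
by move=> [_ xy]; split=> //; apply/FeqE; right.
Qed.

Lemma Feq_class_notUS (U : supertropicalType) (S : set U) (x : U) :
  ~ US S x -> [set y | [set: U] y /\ Feq S x y] = [set x].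
Proof.
move=> nUSx; apply/seteqP; split=> y /=.
  by move=> [_ /FeqE[//|/S_connected_US[]]].
by move=> ->; split=> //; apply/FeqE; left.
Qed.

Local Close Scope ring_scope.
Unset Implicit Arguments.
Set Strict Implicit.

Theorem theorem6p8 (U : supertropicalType) (S : set U) :
  classes [set: U] (Feq S) =
    S_components S `|` [set [set z] | z in ~` US S].
Proof.
apply/seteqP; split=> [_ [x _ <-]|C].
  have [USx|nUSx] := pselect (US S x).
    by left; exists x => //; rewrite Feq_class_US.
  by right; exists x => //; rewrite Feq_class_notUS.
case=> -[x USx <-]; exists x => //; first exact: Feq_class_US.
exact: Feq_class_notUS.
Qed.
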